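(* For every integer $n>2$, $$2^{n-2}-1=\sum_{k=1}^{n}\sum_{i=1}^k\sum_{j=i}^{\left\lfloor\frac{n-k}{2}\right\rfloor}\binom{k}{i}\binom{j-1}{i-1}\binom{n-k-j-1}{j-1}.$$
   Context: Sums whose upper limit is smaller than the lower limit are $0$. *)

(* Defs.v *)
From mathcomp Require Import all_boot.
Set Implicit Arguments.
Unset Strict Implicit.
Unset Printing Implicit Defensive.

(* Main.v *)
Require Import Defs.
From mathcomp Require Import all_boot.
From mathcomp Require Import zify.

(** The inner sum over [i] is a Vandermonde convolution with value
    [binom(k + j - 1, j)] ([Vandermonde_shift]).  For fixed [j], what remains
    is a sum over [k] of products of two binomials whose upper indices
    [k + j - 1] and [n - k - j - 1] add up to [n - 2], while the lower indices
    [j] and [j - 1] are fixed; the Chu-Vandermonde convolution on upper indices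
    ([Vandermonde_upper]) evaluates it to [binom(n - 1, 2 j)].  Finally the
    binomials [binom(n - 1, 2 j)] with [j >= 1] count the nonempty subsets of
    even size of a set with [n - 1] elements, which gives [2 ^ (n - 2) - 1]
    ([sum_bin_even]). *)

(** After the symmetry [binom(k, i + 1) = binom(k, k - 1 - i)] this is the
    Vandermonde convolution for the coefficient of [X ^ (k - 1)] in
    [(1 + X) ^ j * (1 + X) ^ k]. *)
Lemma Vandermonde_shift (k j : nat) :
  0 < k -> \sum_(i < k) 'C(k, i.+1) * 'C(j, i) = 'C(k + j, j.+1).
Proof.
case: k => // k _.
have -> : 'C(k.+1 + j, j.+1) = 'C(j + k.+1, k).
  rewrite -(@bin_sub (j + k.+1) k); last by lia.
  by congr 'C(_, _); lia.
rewrite -Vandermonde; apply: eq_bigr => i _.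
by rewrite mulnC -(@bin_sub k.+1 i.+1).
Qed.

(** Choosing [p + q + 1] elements of [{0, ..., m}] amounts to choosing the
    [(p + 1)]-st smallest one, [a], then [p] elements below it and [q] above. *)
Lemma Vandermonde_upper (m p q : nat) :
  \sum_(a < m.+1) 'C(a, p) * 'C(m - a, q) = 'C(m.+1, (p + q).+1).
Proof.
elim: m q => [|m IHm] [|q].
- by rewrite big_ord1 bin0 addn0 muln1 binS bin0n; case: p.
- by rewrite big_ord1 /= bin0n muln0 bin_small //; lia.
- rewrite big_ord_recr /= subnn bin0 muln1 addn0 binS; congr (_ + _).
  rewrite -[p in RHS]addn0 -IHm.
  by apply: eq_bigr => a _; rewrite !bin0.
rewrite big_ord_recr /= subnn bin0n muln0 addn0 binS addnS -IHm -addnS -IHm.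
rewrite addnC -big_split /=; apply: eq_bigr => a _.
by rewrite subSn 1?leq_ord // binS mulnDr addnC.
Qed.

Lemma sum_bin_row (m t : nat) : m <= t -> \sum_(i < t.+1) 'C(m, i) = 2 ^ m.
Proof.
elim: t => [|t IHt] le_mt.
  by have -> : m = 0 by [lia]; rewrite big_ord1.
have [lt_mt | le_tm] := leqP m t.
  by rewrite big_ord_recr /= IHt // bin_small ?addn0.
have -> : t.+1 = m by lia.
rewrite -[2]/(1 + 1) expnDn.
by apply: eq_bigr => i _; rewrite !exp1n !muln1.
Qed.

(** Pascal's rule splits each [binom(m + 1, 2 j)] into the two consecutive
    terms [2 j - 1] and [2 j] of row [m], so the sum over [j >= 1] runs through
    that whole row except its first term. *)
Lemma sum_bin_even (m t : nat) :
  m <= t.*2 -> \sum_(j < t) 'C(m.+1, j.+1.*2) = 2 ^ m - 1.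
Proof.
move=> /sum_bin_row <-.
suff -> : \sum_(i < t.*2.+1) 'C(m, i) = (\sum_(j < t) 'C(m.+1, j.+1.*2)).+1.
  by rewrite subn1.
elim: t => [|t IHt]; first by rewrite big_ord1 bin0 big_ord0.
rewrite doubleS [in RHS]big_ord_recr 2!big_ord_recr /= IHt.
by rewrite doubleS binS !addSn -addnA ['C(m, _) + _]addnC.
Qed.

(** Both indices are shifted down by one.  The range of [j] may then start at
    [0] for every [i], since [binom(j, i)] vanishes for [j < i], and the order
    of summation can be exchanged.  The condition [k + 2 (j + 1) <= n] must stay:
    without it the truncated difference [n - k - j.+2] would make the term
    [j = 0] nonzero for [k >= n - 1]. *)
Lemma sum_over_i (n k : nat) : 0 < k ->
  \sum_(1 <= i < k.+1) \sum_(i <= j < ((n - k) %/ 2).+1)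
     'C(k, i) * 'C(j - 1, i - 1) * 'C(n - k - j - 1, j - 1) =
  \sum_(j < n | k + j.+1.*2 <= n) 'C(k + j, j.+1) * 'C(n - k - j.+2, j).
Proof.
move=> k_gt0; rewrite big_add1 /= big_mkord.
transitivity (\sum_(i < k) \sum_(j < n | k + j.+1.*2 <= n)
    'C(k, i.+1) * 'C(j, i) * 'C(n - k - j.+2, j)).
  apply: eq_bigr => i _; rewrite big_add1 /=.
  rewrite (big_nat_widenl _ 0) // (big_nat_widen _ _ n) //=; last by lia.
  rewrite big_mkord [LHS]big_mkcond [RHS]big_mkcond /=.
  apply: eq_bigr => j _.
  have -> : (j < (n - k) %/ 2) = (k + j.+1.*2 <= n) by lia.
  rewrite !subn1 /=.
  have -> : (n - k - j.+1).-1 = n - k - j.+2 by lia.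
  case: (leqP i j) => [// | lt_ji] /=.
  by rewrite ['C(j, i)]bin_small // muln0 mul0n if_same.
rewrite exchange_big /=; apply: eq_bigr => j _.
by rewrite -big_distrl /= Vandermonde_shift.
Qed.

(** With [a = k + j], the factors are [binom(a, j + 1)] and
    [binom(n - 2 - a, j)], and the range of [k] is [j < a <= n - 2 - j]; the
    other [a] in [{0, ..., n - 2}] contribute [0] to [Vandermonde_upper]. *)
Lemma sum_over_k (n j : nat) : 1 < n ->
  \sum_(1 <= k < n.+1 | k + j.+1.*2 <= n) 'C(k + j, j.+1) * 'C(n - k - j.+2, j)
  = 'C(n - 1, j.+1.*2).
Proof.
move=> n_gt1.
have -> : 'C(n - 1, j.+1.*2) = 'C((n - 2).+1, (j.+1 + j).+1).
  by congr 'C(_, _); lia.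
rewrite -Vandermonde_upper.
transitivity (\sum_(1 + j <= a < n.+1 + j | a + j.+2 <= n)
    'C(a, j.+1) * 'C(n - 2 - a, j)).
  rewrite big_addn addnK; apply: eq_big => [k | k _]; first by lia.
  by congr (_ * 'C(_, _)); lia.
rewrite (big_nat_widenl _ 0) //.
rewrite -[RHS](big_mkord xpredT (fun a => 'C(a, j.+1) * 'C(n - 2 - a, j))).
rewrite (big_nat_widen 0 (n - 2).+1 (n.+1 + j)) /=; last by lia.
rewrite big_mkcond [RHS]big_mkcond /=; apply: eq_bigr => a _.
case: ifP => [/andP[ajn ja] | out]; first by rewrite ifT //; lia.
case: ifP => // a_lt; have [lt_aj | le_ja] := ltnP a j.+1.
  by rewrite bin_small.
by rewrite ['C(n - 2 - a, j)]bin_small ?muln0 //; lia.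
Qed.

Theorem mainTheorem16 (n : nat) (hn : 2 < n) :
  2 ^ (n - 2) - 1 =
  \sum_(1 <= k < n.+1) \sum_(1 <= i < k.+1) \sum_(i <= j < ((n - k) %/ 2).+1)
     'C(k, i) * 'C(j - 1, i - 1) * 'C(n - k - j - 1, j - 1).
Proof.
rewrite -(@sum_bin_even _ n); last by lia.
rewrite (eq_big_nat _ _ (fun k k_bounds => sum_over_i n k (proj1 (andP k_bounds)))).
rewrite (exchange_big_dep xpredT) //=.
by apply: eq_bigr => j _; rewrite sum_over_k //; [congr 'C(_, _); lia | lia].
Qed.
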